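(* There exists an absolute constant $C>0$ such that for every $d\geq 1$, $\vec r(\vec Q_d) \leq C d^3 17^d$.
   Context: The oriented hypercube $\vec Q_d$ has vertex set $\{0,1\}^d$, with an edge from $x$ to $y$ whenever $y$ is obtained from $x$ by changing exactly one coordinate from $0$ to $1$. A tournament is an orientation of a complete graph. For an acyclic digraph $G$, the oriented Ramsey number $\vec r(G)$ is the smallest $N$ such that every tournament on $N$ vertices contains a copy of $G$. *)

(* Defs.v *)
From HB Require Import structures.
From mathcomp Require Import all_boot all_order all_algebra.
From mathcomp Require Import all_classical all_reals.
From mathcomp Require Import zify.

Set Implicit Arguments.
Unset Strict Implicit.
Unset Printing Implicit Defensive.

(** A digraph on a finite vertex type [V] is its edge relation [g : rel V]. *)

(* [path.cycle g c] reads [c] cyclically, so loops and 2-cycles are excluded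
   too. *)
Definition acyclic (V : finType) (g : rel V) : Prop :=
  forall c : seq V, cycle g c -> c = [::].

Definition tournament (T : finType) (e : rel T) : Prop :=
  irreflexive e /\ forall x y : T, x != y -> e x y (+) e y x.

(* A copy is a subgraph, not necessarily an induced one. *)
Definition contains_copy (V T : finType) (g : rel V) (e : rel T) : Prop :=
  exists f : V -> T,
    injective f /\ forall x y : V, g x y -> e (f x) (f y).

Definition unavoidable (V : finType) (g : rel V) (N : nat) : Prop :=
  forall (T : finType) (e : rel T),
    #|T| = N -> tournament e -> contains_copy g e.

Lemma transitive_subtournament (T : finType) (e : rel T) (n : nat)
    (A : {set T}) : tournament e -> 2 ^ n <= #|A| ->
  exists s : seq T,
    [/\ size s = n, uniq s, {subset s <= A} & pairwise e s].
Proof.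
move=> [eirr etot]; elim: n A => [|n IHn] A leA; first by exists [::].
have /card_gt0P[x xA] : 0 < #|A| by apply: leq_trans leA; rewrite expn_gt0.
pose Out := [set y in A | e x y]; pose In := [set y in A | e y x].
have AE : A = x |: (Out :|: In).
  apply/setP=> y; rewrite !inE; case: eqVneq => [->|yx] /=; first by rewrite xA.
  by rewrite -andb_orr; have := etot _ _ yx; case: (e x y); case: (e y x);
    rewrite ?andbT.
have [/IHn[s [ss us sA ps]]|ltO] := leqP (2 ^ n) #|Out|.
  exists (x :: s); split=> /=; first by rewrite ss.
  - by rewrite us andbT; apply/negP => /sA; rewrite inE eirr andbF.
  - by move=> y; rewrite inE => /predU1P[->//|/sA]; rewrite inE => /andP[].
  - by rewrite ps andbT; apply/allP => y /sA; rewrite inE => /andP[].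
have [/IHn[s [ss us sA ps]]|ltI] := leqP (2 ^ n) #|In|.
  exists (rcons s x); split; first by rewrite size_rcons ss.
  - by rewrite rcons_uniq us andbT; apply/negP => /sA; rewrite inE eirr andbF.
  - by move=> y; rewrite mem_rcons inE => /predU1P[->//|/sA];
      rewrite inE => /andP[].
  - by rewrite pairwise_rcons ps andbT; apply/allP => y /sA;
      rewrite inE => /andP[].
have := cardsU1 x (Out :|: In); rewrite -AE => cA.
have := (leq_card_setU Out In).1; move: leA; rewrite cA expnS.
have := leq_b1 (x \notin Out :|: In); move: ltO ltI; lia.
Qed.

Lemma acyclic_height (V : finType) (g : rel V) : acyclic g ->
  exists h : V -> nat, forall x y, g x y -> h x < h y.
Proof.
move=> acg; exists (fun x => #|[set y | connect g y x]|) => x y gxy.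
apply: proper_card; apply/properP; split.
  apply/fintype.subsetP=> z; rewrite !inE => /connect_trans; apply.
  exact: connect1.
exists y; rewrite !inE ?connect0 //; apply/negP => /connectP[p pp xE].
suff : cycle g (y :: p) by move/acg.
by rewrite /= rcons_path pp -xE.
Qed.

Lemma unavoidable_exists (V : finType) (g : rel V) :
  acyclic g -> exists N, unavoidable g N.
Proof.
move=> /acyclic_height[h hg]; exists (2 ^ #|V|) => T e cT te.
have [|s [ss us _ ps]] := @transitive_subtournament T e #|V| [set: T] te.
  by rewrite cardsT cT.
pose le_h := relpre h leq; pose t := sort le_h (enum V).
have tE x : x \in t by rewrite mem_sort mem_enum.
have st : size t = #|V| by rewrite size_sort -cardE.
have le_tr : transitive le_h by move=> y x z; apply: leq_trans.
have t_sorted : sorted le_h t by apply: sort_sorted => x y; apply: leq_total.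
have it x : index x t < size s by rewrite ss -st index_mem.
have /card_gt0P[x0 _] : 0 < #|[set: T]| by rewrite cardsT cT expn_gt0.
exists (fun x => nth x0 s (index x t)); split=> [x y|x y gxy].
  move=> /eqP; rewrite nth_uniq // => /eqP ixy.
  by rewrite -(nth_index x (tE x)) ixy nth_index.
apply: (pairwiseP x0 ps); rewrite ?inE ?it // ltnNge; apply/negP => iyx.
have le_hh : reflexive le_h by move=> z; apply: leqnn.
have := sorted_leq_index le_tr le_hh t_sorted _ _ (tE y) (tE x) iyx.
by rewrite /le_h /= leqNgt hg.
Qed.

Lemma oriented_ramsey_ex (V : finType) (g : rel V) :
  acyclic g -> exists N, `[< unavoidable g N >].
Proof. by move=> /unavoidable_exists[N gN]; exists N; apply/asboolP. Qed.

Definition oriented_ramsey (V : finType) (g : rel V) (acg : acyclic g) : nat :=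
  ex_minn (oriented_ramsey_ex acg).

Lemma oriented_ramseyP (V : finType) (g : rel V) (acg : acyclic g) :
  unavoidable g (oriented_ramsey acg) /\
  forall N, unavoidable g N -> oriented_ramsey acg <= N.
Proof.
rewrite /oriented_ramsey; case: ex_minnP => m /asboolP gm m_min.
by split=> // N gN; apply/m_min/asboolP.
Qed.

Definition hypercube_vertex (d : nat) : finType := {ffun 'I_d -> bool}.

Definition hypercube_edge (d : nat) : rel (hypercube_vertex d) :=
  fun x y => [exists i : 'I_d, [&& ~~ x i, y i &
    [forall j : 'I_d, (j != i) ==> (x j == y j)]]].

Lemma hypercube_acyclic (d : nat) : acyclic (@hypercube_edge d).
Proof.
pose w (x : hypercube_vertex d) := #|[set i | x i]|.
have lt_w x y : hypercube_edge x y -> w x < w y.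
  move=> /existsP[i /and3P[xi yi /forallP xy]].
  apply: proper_card; apply/properP; split; last by exists i; rewrite inE.
  apply/fintype.subsetP=> j; rewrite !inE; case: (eqVneq j i) => [->//|ji].
  by have := xy j; rewrite ji => /eqP ->.
case=> // x p /= xp; exfalso.
have w_tr : transitive (relpre w ltn) by move=> b a c; apply: ltn_trans.
have : path (relpre w ltn) x (rcons p x) by apply: sub_path xp.
rewrite path_sortedE // => /andP[/allP/(_ x)].
by rewrite mem_rcons inE eqxx /= ltnn => /(_ isT).
Qed.

(* Main.v *)
Require Import Defs.
From mathcomp Require Import all_boot all_order all_algebra.
From mathcomp Require Import all_classical all_reals.
(* [finset] again, so that [set0], [setP], ... refer to finite sets rather than
   to [classical_sets]. *)
From mathcomp Require Import fintype finset zify.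

(* Order the tournament so that the number of forward edges is maximal and cut
   the order into O(d^2) blocks of length l = O(d 17^d).  Every vertex then
   receives edges from nearly half of the last 4d blocks before its own.  Going
   down from the top level of the cube, build sets U_d, ..., U_0 in earlier and
   earlier blocks: given U_(i+1), some block among the preceding 4d sends to it
   a fraction (1 - 1/4d)/2 of all edges, and U_i consists of the common
   in-neighbours in that block of 2(i+1) random vertices of U_(i+1).  By
   dependent random choice few (i+1)-tuples of U_i have fewer than
   |U_(i+1)| / (2d 4^(i+1)) common out-neighbours in U_(i+1), and
   l >= 64 d C(d,i) 16^i makes U_i large enough; this holds for every i because
   the sum of the C(d,i) 16^i is 17^d.  The cube is then embedded greedily from
   the bottom level up, never letting a partially embedded in-neighbourhood have
   too many bad completions. *)

Set Implicit Arguments.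
Unset Strict Implicit.
Unset Printing Implicit Defensive.

(** * Power means and words *)

Lemma leq_sum_exists (I : Type) (r : seq I) (F E : I -> nat) :
  0 < size r -> \sum_(i <- r) F i <= \sum_(i <- r) E i -> exists i, F i <= E i.
Proof.
elim: r => // i r IHr _; rewrite !big_cons.
have [leFE|ltEF] := leqP (F i) (E i); first by exists i.
case: r IHr => [|j r] IHr; first by rewrite !big_nil; lia.
by move=> leS; apply: IHr => //; lia.
Qed.

(** Sum [(a - b)(a^n - b^n) >= 0] over all ordered pairs of entries; every product of sums then
    appears twice, hence the doubling in the proof. *)
Lemma chebyshev_sum (I : Type) (r : seq I) (F : I -> nat) (n : nat) :
  (\sum_(i <- r) F i) * (\sum_(i <- r) F i ^ n) <=
  size r * \sum_(i <- r) F i ^ n.+1.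
Proof.
have ineq a b : a * b ^ n + b * a ^ n <= a ^ n.+1 + b ^ n.+1.
  case: n => [|n]; first by rewrite !expn0 !expn1 !muln1 addnC.
  rewrite [a ^ n.+2]expnS [b ^ n.+2]expnS.
  have [leab|/ltnW leba] := leqP a b.
    by have := leab; rewrite -(@leq_exp2r a b n.+1) //; nia.
  by have := leba; rewrite -(@leq_exp2r b a n.+1) //; nia.
rewrite -(leq_pmul2l (isT : 0 < 2)) !mul2n -!addnn.
rewrite {1}big_distrlr [X in _ + X <= _]big_distrlr /=.
rewrite [X in _ + X <= _]exchange_big /= -big_split /=.
rewrite -sum1_size big_distrlr /= [X in _ <= X + _]exchange_big /=.
rewrite -big_split /=.
apply: leq_sum => i _; rewrite -!big_split /=; apply: leq_sum => j _.
by rewrite !mul1n; exact: ineq.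
Qed.

Lemma power_mean (I : Type) (r : seq I) (F : I -> nat) (n : nat) :
  (\sum_(i <- r) F i) ^ n * size r <= size r ^ n * \sum_(i <- r) F i ^ n.
Proof.
elim: n => [|n IHn]; first by rewrite !mul1n sum1_size.
rewrite expnS -mulnA (leq_trans (leq_mul (leqnn _) IHn)) //.
rewrite mulnCA (leq_trans (leq_mul (leqnn _) (chebyshev_sum r F n))) //.
by rewrite mulnA -expnSr.
Qed.

Section Words.
Variable T : finType.
Implicit Types (A : {set T}) (P : pred T).

(** Repetitions are allowed: a sum over this list, divided by [#|A| ^ n], is an expectation over [n]
    independent uniform choices from [A]. *)
Fixpoint words n A : seq (seq T) :=
  if n is m.+1 then [seq x :: w | x <- enum A, w <- words m A] else [:: [::]].

Lemma big_words0 A (F : seq T -> nat) : \sum_(w <- words 0 A) F w = F [::].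
Proof. exact: big_seq1. Qed.

Lemma big_wordsS n A (F : seq T -> nat) :
  \sum_(w <- words n.+1 A) F w =
  \sum_(x in A) \sum_(w <- words n A) F (x :: w).
Proof. by rewrite big_allpairs_dep big_enum. Qed.

Lemma size_words n A : size (words n A) = #|A| ^ n.
Proof. by elim: n => //= n IHn; rewrite size_allpairs IHn -cardE expnS. Qed.

Lemma big_words_filter n A P (F : seq T -> nat) :
  \sum_(w <- words n A) all P w * F w =
  \sum_(w <- words n [set x in A | P x]) F w.
Proof.
elim: n F => [|n IHn] F; first by rewrite !big_words0 mul1n.
rewrite !big_wordsS [LHS]big_mkcond [RHS]big_mkcond /=; apply: eq_bigr => x _.
rewrite inE; case: (x \in A) => //=; case: (P x) => /=; first exact: IHn.
by rewrite big1_seq.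
Qed.

Lemma sum_words_all n A P :
  \sum_(w <- words n A) all P w = #|[set x in A | P x]| ^ n.
Proof.
rewrite -size_words -sum1_size -big_words_filter.
by apply: eq_bigr => w _; rewrite muln1.
Qed.

End Words.

(** * Dependent random choice *)

Section DependentRandomChoice.
Variables (T : finType) (e : rel T).
Implicit Types (A U X : {set T}) (w : seq T).

Definition out_nbrs U w := [set u in U | all (e^~ u) w].
Definition in_nbrs A w := [set a in A | all (e a) w].

Definition scarce U G X : bool := #|out_nbrs U (enum X)| * G < #|U|.

Lemma out_nbrs_enum U w : out_nbrs U (enum [set y in w]) = out_nbrs U w.
Proof.
apply/setP=> u; rewrite !inE; congr (_ && _); apply: eq_all_r => y.
by rewrite mem_enum inE.
Qed.

(** Double counting: a word [w] over [A] survives in [in_nbrs A s] exactly when all letters of [s]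
    lie in [out_nbrs U w], which happens for [#|out_nbrs U w| ^ t] words [s]. *)
Lemma sum_in_nbrs h t A U (F : seq T -> nat) :
  \sum_(s <- words t U) \sum_(w <- words h (in_nbrs A s)) F w =
  \sum_(w <- words h A) #|out_nbrs U w| ^ t * F w.
Proof.
transitivity (\sum_(s <- words t U) \sum_(w <- words h A)
    all (fun a => all (e a) s) w * F w).
  by apply: eq_bigr => s _; rewrite big_words_filter.
rewrite exchange_big; apply: eq_bigr => w _ /=.
rewrite -big_distrl /= -sum_words_all; congr (_ * _); apply: eq_bigr => s _.
by rewrite -!/(allrel _ _ _) allrelC.
Qed.

(** If the edge density from [A] to [U] is at least [p / q], then the mean of [#|in_nbrs A s| ^ h]
    is at least [(p / q)^(ht) #|A|^h]. Two power means give this: over [U] with exponent [h], then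
    over words of [A] with exponent [t]. *)
Lemma dense_in_nbrs h t p q A U : 0 < #|A| -> 0 < #|U| ->
  p * (#|A| * #|U|) <= q * \sum_(u in U) #|[set a in A | e a u]| ->
  p ^ (h * t) * (#|A| ^ h * #|U| ^ t) <=
  q ^ (h * t) * \sum_(s <- words t U) #|in_nbrs A s| ^ h.
Proof.
move=> A0 U0; set E := \sum_(u in U) _ => leE.
set P := \sum_(s <- _) _.
(* [M] counts pairs of a vertex [u] and a word of [h] in-neighbours of [u]; counted from the side of
   the words, it feeds the second power mean. *)
pose M := \sum_(u in U) #|[set a in A | e a u]| ^ h.
have ltM : E ^ h * #|U| <= #|U| ^ h * M.
  have := power_mean (enum U) (fun u => #|[set a in A | e a u]|) h.
  by rewrite -cardE !big_enum.
have leP : M ^ t * #|A| ^ h <= #|A| ^ (h * t) * P.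
  have -> : M = \sum_(w <- words h A) #|out_nbrs U w|.
    transitivity (\sum_(s <- words 1 U) \sum_(w <- words h (in_nbrs A s)) 1).
      rewrite big_wordsS; apply: eq_bigr => u _.
      rewrite big_words0 sum1_size size_words; congr (_ ^ _); apply: eq_card.
      by move=> a; rewrite !inE /= andbT.
    by rewrite sum_in_nbrs; apply: eq_bigr => w _; rewrite muln1 expn1.
  have -> : P = \sum_(w <- words h A) #|out_nbrs U w| ^ t.
    transitivity (\sum_(s <- words t U) \sum_(w <- words h (in_nbrs A s)) 1).
      by apply: eq_bigr => s _; rewrite sum1_size size_words.
    by rewrite sum_in_nbrs; apply: eq_bigr => w _; rewrite muln1.
  by rewrite expnM -size_words; apply: power_mean.
pose K := (#|A| * #|U|) ^ (h * t).
have K0 : 0 < K by rewrite expn_gt0 muln_gt0 A0 U0.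
rewrite -(leq_pmul2l K0).
have leEP : E ^ (h * t) * (#|A| ^ h * #|U| ^ t) <= K * P.
  have leME : E ^ (h * t) * #|U| ^ t <= #|U| ^ (h * t) * M ^ t.
    rewrite !expnM -!expnMn.
    by case: (t) => // t'; rewrite leq_exp2r.
  rewrite (mulnC (#|A| ^ h)) mulnA (leq_trans (leq_mul leME (leqnn _))) //.
  by rewrite /K expnMn (mulnC (#|A| ^ _)) -!mulnA leq_mul.
apply: leq_trans (_ : q ^ (h * t) * (E ^ (h * t) * (#|A| ^ h * #|U| ^ t)) <= _).
  rewrite !mulnA; do 2!apply: leq_mul => //.
  rewrite mulnC -!expnMn; case: (h * t) => // n; rewrite leq_exp2r //.
by rewrite [leqRHS]mulnCA leq_mul.
Qed.

(* [n] elements are still to be added to [X]: more than a fraction [1 / B] of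
   the choices for the next one lead to another dangerous set. *)
Fixpoint dangerous U B (bad : pred {set T}) n X : bool :=
  if n is m.+1 then
    #|U| < #|[set y in U | dangerous U B bad m (y |: X)]| * B
  else bad X.

(** Each of the [n] recursion levels keeps more than a fraction [1 / B] of the choices, and these
    fractions multiply. *)
Lemma dangerous_count U B (bad : pred {set T}) n X : dangerous U B bad n X ->
  #|U| ^ n <= B ^ n * \sum_(w <- words n U) bad ([set y in w] :|: X).
Proof.
elim: n X => [|n IHn] X.
  rewrite big_seq1 mul1n (_ : [set y in [::]] = set0) ?set0U => [/= ->|]//.
move=> /= ltU; rewrite [X in _ * X]big_wordsS !expnS.
set D := [set y in U | _] in ltU.
apply: leq_trans (_ : #|D| * B * #|U| ^ n <= _).
  by rewrite leq_mul // ltnW.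
rewrite (mulnC #|D|) -!mulnA leq_mul //.
rewrite -sum_nat_const big_distrr /= [leqRHS](bigID (mem D)) /=.
apply: leq_trans (leq_addr _ _).
rewrite [leqLHS](eq_bigl (fun i => (i \in U) && (i \in D))); last first.
  by move=> y; rewrite !inE; case: (y \in U).
apply: leq_sum => y /andP[_]; rewrite inE => /andP[_ /IHn /leq_trans]; apply.
rewrite leq_mul //; apply: leq_sum => w _.
by rewrite set_cons setUA [y |: _]setUC -setUA.
Qed.

(** Take [W = in_nbrs A s] for a random [s] of length [t]. A scarce word survives with probability
    at most [G^-t], so few are expected in [W], while the mean of [#|W|^h] is large. The last two
    hypotheses say that [k^h] and [B^h] times the expected number of scarce words each cost at most
    half of that mean. *)
Lemma dependent_random_choice A U h t p q B G k :
  0 < h -> 0 < k -> 0 < q -> 0 < #|A| -> 0 < #|U| ->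
  p * (#|A| * #|U|) <= q * \sum_(u in U) #|[set a in A | e a u]| ->
  2 * (q ^ t * k) ^ h <= (p ^ t * #|A|) ^ h ->
  2 * (q ^ (h * t) * B ^ h) <= p ^ (h * t) * G ^ t ->
  exists2 W : {set T}, W \subset A & k <= #|W| /\
    ~~ dangerous W B (scarce U G) h set0.
Proof.
move=> h0 k0 q0 A0 U0 /(dense_in_nbrs h t A0 U0) dense leK leB.
pose bad W := \sum_(w <- words h W) scarce U G [set y in w].
have leQ : G ^ t * \sum_(s <- words t U) bad (in_nbrs A s) <=
    #|A| ^ h * #|U| ^ t.
  rewrite sum_in_nbrs -size_words -sum1_size big_distrr big_distrl /=.
  apply: leq_sum => w _; rewrite mul1n mulnA -expnMn.
  have [/ltnW ltU|_] := boolP (scarce U G [set y in w]); last by rewrite muln0.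
  rewrite /scarce out_nbrs_enum in ltU.
  by rewrite muln1 mulnC; case: t {dense leK leB} => // t; rewrite leq_exp2r.
have [] := @leq_sum_exists _ (words t U)
    (fun s => bad (in_nbrs A s) * B ^ h + k ^ h)
    (fun s => #|in_nbrs A s| ^ h).
- by rewrite size_words expn_gt0 U0.
- set K := q ^ (h * t) in dense leB.
  have K0 : 0 < 2 * K by rewrite muln_gt0 expn_gt0 q0.
  rewrite -(leq_pmul2l K0) big_split /= -big_distrl /= big_const_seq iter_addn_0.
  set Q := \sum_(s <- _) bad _ in leQ *; set P := \sum_(s <- _) _ in dense *.
  rewrite count_predT size_words (mulnC (k ^ h)).
  have leK2 : 2 * K * k ^ h <= p ^ (h * t) * #|A| ^ h.
    by rewrite /K (mulnC h t) !expnM -mulnA -!expnMn.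
  have le1 : 2 * K * (Q * B ^ h) <= K * P.
    apply: leq_trans dense; apply: leq_trans (leq_mul (leqnn _) leQ).
    by rewrite (mulnA (p ^ _)) (mulnC Q) mulnA -(mulnA 2) leq_mul.
  have le2 : 2 * K * (#|U| ^ t * k ^ h) <= K * P.
    apply: leq_trans dense.
    by rewrite mulnA (mulnAC _ (#|U| ^ t)) (mulnA (p ^ _)) leq_mul.
  by rewrite mulnDr; move: le1 le2; lia.
move=> s les; exists (in_nbrs A s).
  by apply/subsetP => a; rewrite inE => /andP[].
split; first by rewrite -(leq_exp2r _ _ h0) (leq_trans _ les) // leq_addl.
apply/negP=> /dangerous_count; under eq_bigr do rewrite setU0.
(* Since [k ^ h > 0], the bound on the scarce words of [W] is strict, which contradicts
   [dangerous_count]. *)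
rewrite -/(bad _) => leW; have := expn_gt0 k h; rewrite k0 /=.
by move: (leq_trans les leW); lia.
Qed.

End DependentRandomChoice.

(** * Median orders *)

Section MedianOrder.
Variables (T : finType) (e : rel T).
Implicit Types s : seq T.

Fixpoint forward_edges s : nat :=
  if s is x :: s' then count (e x) s' + forward_edges s' else 0.

Lemma forward_edges_cat s1 s2 : forward_edges (s1 ++ s2) =
  forward_edges s1 + forward_edges s2 + \sum_(x <- s1) count (e x) s2.
Proof.
elim: s1 => [|x s1 IH] /=; first by rewrite big_nil addn0.
by rewrite big_cons count_cat IH; lia.
Qed.

(** Only the pairs formed by [x] and an entry of [q] change order. The identity is written
    additively to avoid truncated subtraction. *)
Lemma forward_edges_move p q x r :
  forward_edges (p ++ q ++ x :: r) + count (e x) q =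
  forward_edges (p ++ x :: q ++ r) + count (e^~ x) q.
Proof.
have cross : \sum_(y <- q) count (e y) (x :: r) =
    count (e^~ x) q + \sum_(y <- q) count (e y) r.
  by elim: q => [|y q IHq] /=; rewrite ?big_nil // !big_cons IHq /=; lia.
rewrite !forward_edges_cat /= !forward_edges_cat cross count_cat.
have -> : \sum_(y <- p) count (e y) (x :: q ++ r) =
    \sum_(y <- p) count (e y) (q ++ x :: r).
  by apply: eq_bigr => y _; rewrite /= !count_cat /=; lia.
by rewrite /=; lia.
Qed.

(* Take an order with the most forward edges: moving [x] to an earlier place
   cannot increase their number. *)
Lemma median_order : tournament e ->
  exists s, [/\ uniq s, s =i T &
    forall p q x r, s = p ++ q ++ x :: r -> size q <= 2 * count (e^~ x) q].
Proof.
move=> [eirr etot]; pose t0 := in_tuple (enum T).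
have [t tP tmax] := arg_maxnP (P := fun t : (size (enum T)).-tuple T =>
  perm_eq t (enum T)) (forward_edges \o val) (perm_refl _ : perm_eq t0 _).
have ut : uniq t by rewrite (perm_uniq tP) enum_uniq.
exists t; split=> // [x|p q x r tE]; first by rewrite (perm_mem tP) mem_enum.
pose t' := p ++ x :: q ++ r.
have t'P : perm_eq t' (enum T).
  by rewrite -(permPr tP) tE perm_cat2l perm_sym -[x :: r]cat1s perm_catCA.
have st' : size t' == size (enum T) by rewrite (perm_size t'P).
have := tmax (Tuple st') t'P; rewrite /= /t' tE.
have := forward_edges_move p q x r.
have xNq : x \notin q.
  apply/negP=> xq; move: ut.
  by rewrite tE !cat_uniq /= negb_or xq !andbF.
have -> : count (e x) q = count (predC (e^~ x)) q.
  apply: eq_in_count => y yq; have := etot x y.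
  case: eqVneq => [yx|_ /(_ isT)] /=; first by rewrite yx yq in xNq.
  by case: (e x y); case: (e y x).
by have := count_predC (e^~ x) q; lia.
Qed.

Lemma median_ranking : tournament e ->
  exists pos : T -> nat, [/\ injective pos, forall x, pos x < #|T| &
    forall i x, i <= pos x ->
      pos x - i <= 2 * #|[set y | i <= pos y < pos x & e y x]|].
Proof.
move=> /median_order[s [us sT smed]]; exists (index^~ s).
have ss : size s = #|T|.
  rewrite cardT; apply: perm_size; apply: uniq_perm => [||x] //.
    exact: enum_uniq.
  by rewrite sT mem_enum.
have ltx x : index x s < size s by rewrite index_mem sT.
split=> [x y|x|i x leix]; last 1 first.
- set k := index x s in leix *.
  pose p := take i s; pose q := drop i (take k s); pose r := drop k.+1 s.
  have ltk : k < size s := ltx x.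
  have sp : size p = i by rewrite size_take; case: ltnP => // ?; lia.
  have sq : size q = k - i by rewrite size_drop size_take ltk.
  have sE : s = p ++ q ++ x :: r.
    rewrite /p /q -(take_takel s leix) catA cat_take_drop.
    rewrite -{1}(nth_index x (_ : x \in s)) ?sT //.
    by rewrite -drop_nth // cat_take_drop.
  have := smed _ _ _ _ sE; rewrite sq => /leq_trans; apply.
  rewrite leq_mul // -size_filter cardE.
  apply: uniq_leq_size.
    by rewrite filter_uniq // drop_uniq // take_uniq.
  move=> y; rewrite mem_filter mem_enum inE => /andP[-> yq]; rewrite andbT.
  have yp : y \notin p.
    by apply/negP=> yp; move: us; rewrite sE cat_uniq => /and3P[_ /hasPn/(_ y)];
      rewrite mem_cat yq yp => /(_ isT).
  rewrite sE index_cat (negPf yp) index_cat yq sp leq_addr /=.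
  by have := yq; rewrite -index_mem sq; lia.
- by move=> xy; rewrite -(nth_index x (_ : x \in s)) ?sT // xy nth_index // sT.
- by rewrite -ss.
Qed.
End MedianOrder.

Section Blocks.
Variables (T : finType) (pos : T -> nat).
Hypotheses (pos_inj : injective pos) (pos_lt : forall x, pos x < #|T|).

Lemma card_pos_range i j : i <= j -> j <= #|T| ->
  #|[set x | i <= pos x < j]| = j - i.
Proof.
move=> leij lejT; have perm_pos : perm_eq (map pos (enum T)) (iota 0 #|T|).
  have upos : uniq (map pos (enum T)) by rewrite map_inj_uniq ?enum_uniq.
  apply: uniq_perm; rewrite ?iota_uniq //.
  apply: (uniq_min_size upos _ _).2; last by rewrite size_iota size_map cardE.
  by move=> n /mapP[x _ ->]; rewrite mem_iota add0n pos_lt.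
rewrite -sum1dep_card.
transitivity (\sum_(k <- map pos (enum T) | i <= k < j) 1).
  by rewrite big_map big_enum_cond; apply: eq_bigl.
rewrite (perm_big _ perm_pos) sum1_count /=.
have -> : #|T| = i + (j - i + (#|T| - j)) by lia.
rewrite !iotaD !count_cat !add0n.
rewrite (@eq_in_count _ _ pred0 (iota 0 i)) => [|k];
  last by rewrite mem_iota /=; lia.
rewrite (@eq_in_count _ _ predT (iota i _)) => [|k];
  last by rewrite mem_iota /=; lia.
rewrite (@eq_in_count _ _ pred0 (iota (i + _) _)) => [|k];
  last by rewrite mem_iota /=; lia.
by rewrite !count_pred0 count_predT size_iota addn0.
Qed.

Variable l : nat.

Definition block b := [set x | b * l <= pos x < b.+1 * l].

Lemma card_range_blocks (P : pred T) i n :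
  #|[set x | i * l <= pos x < (i + n) * l & P x]| <=
  \sum_(j < n) #|[set x in block (i + j) | P x]|.
Proof.
elim: n => [|n IHn].
  rewrite addn0 big_ord0 leqn0 cards_eq0; apply/eqP/setP=> x; rewrite !inE; lia.
rewrite big_ord_recr /=; apply: leq_trans (leq_add IHn (leqnn _)).
apply: leq_trans (leq_card_setU _ _).1; apply: subset_leq_card.
apply/subsetP=> x; rewrite !inE; case: (P x); rewrite ?andbF ?andbT //.
by rewrite addnS; lia.
Qed.

Lemma card_block b : b.+1 * l <= #|T| -> #|block b| = l.
Proof. by move=> leT; rewrite card_pos_range //; lia. Qed.

(** Apply the median property to [u] from the start of block [b - D]. If [u] has [r < l]
    predecessors in its own block, at least [(D l + r) / 2 - r >= (D - 1) l / 2] in-neighbours lie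
    in the [D] blocks before it. Averaging over these blocks gives [c]. *)
Lemma dense_earlier_block (e : rel T) (D b : nat) (U : {set T}) :
  (forall i x, i <= pos x ->
     pos x - i <= 2 * #|[set y | i <= pos y < pos x & e y x]|) ->
  0 < D -> D <= b -> b.+1 * l <= #|T| -> U \subset block b ->
  exists c, [/\ c < b, b <= c + D & D.-1 * (l * #|U|) <=
    2 * D * \sum_(u in U) #|[set a in block c | e a u]|].
Proof.
move=> med D0 leDb lebT /subsetP sUb; set i := b - D.
have dense u : u \in U ->
    D.-1 * l <= 2 * \sum_(j < D) #|[set a in block (i + j) | e a u]|.
  move=> /sUb; rewrite inE => /andP[leu ltu].
  have lei : i * l <= pos u by rewrite (leq_trans _ leu) // leq_mul // leq_subr.
  have := med _ _ lei.
  have := card_range_blocks (e^~ u) i D; rewrite /i subnK // -/i.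
  have := card_pos_range leu (ltnW (pos_lt u)).
  set X1 := [set _ | _]; set X2 := [set _ | _ & _]; set X3 := [set _ | _ & _].
  have leX : #|X3| <= #|X1| + #|X2|.
    apply: leq_trans (leq_card_setU _ _).1; apply: subset_leq_card.
    apply/subsetP=> x; rewrite !inE; case: (e x u); rewrite ?andbF ?andbT //.
    by lia.
  have iE : i * l + D * l = b * l by rewrite -mulnDl /i subnK.
  have -> : D.-1 * l = D * l - l by rewrite -subn1 mulnBl mul1n.
  have : b.+1 * l = b * l + l by rewrite mulSn addnC.
  move: leX; lia.
have [] := @leq_sum_exists _ (enum 'I_D) (fun=> D.-1 * (l * #|U|))
  (fun j => 2 * D * \sum_(u in U) #|[set a in block (i + j) | e a u]|).
- by rewrite size_enum_ord.
- rewrite !big_enum sum_nat_const card_ord -big_distrr /= exchange_big /=.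
  rewrite (mulnC 2) -[leqRHS]mulnA leq_mul // mulnA (mulnC _ #|U|).
  rewrite -sum_nat_const.
  by rewrite big_distrr /=; apply: leq_sum => u /dense.
move=> j lej; exists (i + j); split=> //.
- by have := ltn_ord j; rewrite /i; lia.
- by rewrite /i; lia.
Qed.
End Blocks.

(** * Greedy embedding *)

Section GreedyEmbedding.
Variables (V T : finType) (g : rel V) (e : rel T) (rk : V -> nat).
Variables (U : nat -> {set T}) (G : nat -> nat) (D : nat).

Let ins v := [set x | g x v].
(** Here [X] is the image of the in-neighbours of [v] already placed and [n] the number still
    missing. The factor [2 * D] makes the dangerous choices for up to [D] out-neighbours together
    use at most half of the guaranteed candidates. *)
Let safe v n X := forall i, rk v = i.+1 ->
  ~~ dangerous (U i) (2 * D * G i) (scarce e (U i.+1) (G i.+1)) n X.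

Hypotheses (g_rk : forall x y, g x y -> rk y = (rk x).+1)
  (outdeg : forall x, #|[set y | g x y]| <= D) (D_gt0 : 0 < D)
  (G_gt0 : forall i, 0 < G i)
  (U_rk : forall x y t, t \in U (rk x) -> t \in U (rk y) -> rk x = rk y)
  (U_big : forall v, 2 * #|[set x | rk x == rk v]| * G (rk v) <= #|U (rk v)|)
  (ins_safe : forall v, safe v #|ins v| set0).

(* Invariant: [A] is closed under in-neighbours, [f] embeds [A], and every
   in-neighbourhood, even partially embedded, can still be completed. *)
Let partial_embedding (A : {set V}) (f : V -> T) :=
  [/\ forall x y, g x y -> y \in A -> x \in A,
      {in A &, injective f}, {in A, forall x, f x \in U (rk x)},
      {in A &, forall x y, g x y -> e (f x) (f y)} &
      forall v, safe v #|ins v :\: A| (f @: (ins v :&: A))].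

(** At least [#|U (rk x)| / G (rk x)] candidates are adjacent from all placed in-neighbours. Images
    already used exclude less than half of that number, choices endangering an out-neighbour at most
    half, so a candidate remains. *)
Lemma extend_embedding A f x : partial_embedding A f -> x \notin A ->
  ins x \subset A ->
  exists y, partial_embedding (x |: A) (fun z => if z == x then y else f z).
Proof.
move=> [Acl finj fU fe fsafe] xA /subsetP insA.
pose C := [set y in U (rk x) | [forall z in ins x, e (f z) y]].
have leC : #|U (rk x)| <= #|C| * G (rk x).
  (* On level 0 there are no in-neighbours and every vertex is a candidate. Higher up, no
     in-neighbour is missing, so safety with [n = 0] says that the image is not scarce. *)
  case rkx: (rk x) => [|i].
    rewrite [leqLHS](_ : _ = #|C|) ?leq_pmulr //; apply: eq_card => y.
    rewrite !inE rkx; case: (y \in U 0) => //=; apply/esym/forall_inP => z.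
    by rewrite inE => /g_rk; rewrite rkx.
  have := fsafe x _ rkx.
  rewrite (_ : ins x :\: A = set0) ?cards0; last first.
    by apply/eqP; rewrite setD_eq0; apply/subsetP.
  rewrite (_ : ins x :&: A = ins x); last by apply/setIidPl/subsetP.
  rewrite /= /scarce -leqNgt => /leq_trans; apply; rewrite leq_mul //.
  apply/subset_leq_card/subsetP => y; rewrite !inE rkx => /andP[-> /allP fy] /=.
  by apply/forall_inP => z zx; apply: fy; rewrite mem_enum imset_f.
pose K v := [set y in U (rk x) | dangerous (U (rk x)) (2 * D * G (rk x))
  (scarce e (U (rk x).+1) (G (rk x).+1)) #|ins v :\: (x |: A)|
  (y |: f @: (ins v :&: A))].
have leK v : g x v -> #|K v| * (2 * D * G (rk x)) <= #|U (rk x)|.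
  move=> gxv; have := fsafe v _ (g_rk gxv).
  have -> : #|ins v :\: A| = #|ins v :\: (x |: A)|.+1.
    rewrite (cardsD1 x) !inE xA gxv add1n; congr _.+1; apply: eq_card => z.
    by rewrite !inE negb_or andbA.
  by rewrite /= -leqNgt.
(* Only vertices of the same rank can collide with [x], by [U_rk]; [x] itself is not yet placed,
   which makes the bound strict. *)
pose L := [set z in A | rk z == rk x].
have ltL : #|L| < #|[set z | rk z == rk x]|.
  apply: proper_card; apply/properP; split.
    by apply/subsetP => z; rewrite !inE => /andP[].
  by exists x; rewrite !inE ?eqxx // (negPf xA).
have /subsetPn[y yC] : ~~ (C \subset f @: L :|: \bigcup_(v | g x v) K v).
  apply/negP => /subset_leq_card leCU.
  have leCS : #|C| <= #|L| + \sum_(v | g x v) #|K v|.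
    rewrite (leq_trans leCU) // (leq_trans (leq_card_setU _ _).1) //.
    rewrite leq_add ?leq_imset_card //.
    elim/big_ind2: _ => [|n1 X1 n2 X2 le1 le2|//]; first by rewrite cards0.
    by rewrite (leq_trans (leq_card_setU _ _).1) // leq_add.
  have leS : (\sum_(v | g x v) #|K v|) * (2 * G (rk x)) <= #|U (rk x)|.
    rewrite -(leq_pmul2l D_gt0).
    apply: leq_trans (_ : #|[set v | g x v]| * #|U (rk x)| <= _); last first.
      by rewrite leq_mul.
    rewrite -sum1dep_card !big_distrl big_distrr /=; apply: leq_sum => v gxv.
    by rewrite mul1n (leq_trans _ (leK v gxv)) // mulnCA (mulnA D) (mulnC D).
  have := U_big x; have := G_gt0 (rk x); move: leC ltL leCS leS.
  by nia.
rewrite !inE negb_or => /andP[yL yK].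
move: yC; rewrite inE => /andP[yU /forall_inP yin].
exists y; set f' := fun z => _.
have f'A z : z \in A -> f' z = f z.
  by rewrite /f'; case: eqVneq => // ->; rewrite (negPf xA).
have f'x : f' x = y by rewrite /f' eqxx.
have yNf z : z \in A -> f z != y.
  move=> zA; apply: contra yL => /eqP fz; rewrite -fz; apply: imset_f.
  by rewrite inE zA /=; apply/eqP/(U_rk (fU z zA)); rewrite fz.
split.
- move=> z t gzt; rewrite !inE => /predU1P[tx|tA].
    by rewrite insA ?orbT // inE -tx.
  by rewrite (Acl _ _ gzt tA) orbT.
- move=> z t; rewrite !inE => /predU1P[->|zA] /predU1P[->|tA] //.
  + by rewrite f'x f'A // => /esym/eqP; rewrite (negPf (yNf _ tA)).
  + by rewrite f'x f'A // => /eqP; rewrite (negPf (yNf _ zA)).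
  + by rewrite !f'A //; apply: finj.
- move=> z; rewrite !inE => /predU1P[->|zA]; first by rewrite f'x.
  by rewrite f'A // fU.
- move=> z t; rewrite !inE => /predU1P[->|zA] /predU1P[->|tA].
  + by move=> /g_rk /n_Sn.
  + by move=> gxt; case/negP: xA; apply: Acl gxt tA.
  + by move=> gzx; rewrite f'x f'A // yin // inE.
  + by rewrite !f'A //; apply: fe.
move=> v i rkv; have [gxv|Ngxv] := boolP (g x v).
  have irk : i = rk x by have := g_rk gxv; rewrite rkv => -[].
  have -> : f' @: (ins v :&: (x |: A)) = y |: f @: (ins v :&: A).
    rewrite setIUr (_ : ins v :&: [set x] = [set x]); last first.
      by apply/setIidPr/subsetP => z; rewrite !inE => /eqP ->.
    rewrite imsetU1 f'x; congr (_ |: _); apply: eq_in_imset => z.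
    by rewrite inE => /andP[_ /f'A].
  apply: contra yK => yK; apply/bigcupP; exists v => //.
  by rewrite inE yU -irk.
have insE B : ins v :&: (x |: B) = ins v :&: B.
  apply/setP => z; rewrite !inE; case: eqVneq => // ->.
  by rewrite (negPf Ngxv).
have -> : ins v :\: (x |: A) = ins v :\: A.
  apply/setP => z; rewrite !inE; case: eqVneq => // ->.
  by rewrite (negPf Ngxv) !andbF.
rewrite insE (_ : f' @: _ = f @: (ins v :&: A)); first exact: fsafe.
by apply: eq_in_imset => z; rewrite inE => /andP[_ /f'A].
Qed.

Lemma greedy_embedding : contains_copy g e.
Proof.
have partial n : n <= #|V| ->
    exists (A : {set V}) (f : V -> T), #|A| = n /\ partial_embedding A f.
  elim: n => [_|n IHn ltn].
    have /choice[f _] : forall v, exists t, t \in U (rk v).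
      move=> v; apply/card_gt0P/(leq_trans _ (U_big v)).
      rewrite !muln_gt0 G_gt0 andbT; apply/card_gt0P; exists v.
      by rewrite inE.
    exists set0, f; rewrite cards0; split=> //; split=> [x y _|x y|x|x y|v].
    - by rewrite inE.
    - by rewrite inE.
    - by rewrite inE.
    - by rewrite inE.
    - by rewrite setD0 setI0 imset0; apply: ins_safe.
  have [A [f [cA fA]]] := IHn (ltnW ltn).
  have /set0Pn[x0 x0A] : ~: A != set0.
    by rewrite -card_gt0 cardsCs setCK subn_gt0 cA.
  (* A vertex of least rank outside [A] has all its in-neighbours in [A]. *)
  have [x /= xA xmin] := arg_minnP (P := mem (~: A)) rk x0A; rewrite inE in xA.
  have [|y fy] := extend_embedding fA xA.
    apply/subsetP => z; rewrite inE => /g_rk rkx; apply/negPn/negP => zA.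
    by have := xmin z; rewrite inE rkx ltnn => /(_ zA).
  exists (x |: A), (fun z => if z == x then y else f z).
  by rewrite cardsU1 xA cA.
have [A [f [cA [_ finj fU fe _]]]] := partial _ (leqnn _).
have inA x : x \in A.
  suff -> : A = setT by rewrite inE.
  by apply/eqP; rewrite eqEcard subsetT cardsT cA leqnn.
by exists f; split=> [x y|x y]; [apply: finj|apply: fe].
Qed.

End GreedyEmbedding.

(** * The hypercube *)

Section Hypercube.
Variable d : nat.
Implicit Types x y v : hypercube_vertex d.

Definition weight x := #|[set i | x i]|.

Definition flip x (i : 'I_d) : hypercube_vertex d :=
  [ffun j => (j == i) (+) x j].

Lemma flip_inj x : injective (flip x).
Proof.
move=> i j /ffunP/(_ i); rewrite !ffunE eqxx.
by case: eqVneq => //; case: (x i).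
Qed.

Lemma hypercube_edgeP x y :
  reflect (exists2 i, ~~ x i & y = flip x i) (hypercube_edge x y).
Proof.
apply: (iffP existsP).
  move=> [i /and3P[xi yi /forallP xy]]; exists i => //.
  apply/ffunP => j; rewrite ffunE; have := xy j.
  by case: (eqVneq j i) => [->|_ /eqP ->] //=; rewrite (negPf xi) yi.
move=> [i xi ->]; exists i; rewrite xi ffunE eqxx (negPf xi) /=.
apply/forallP => j; apply/implyP => /negPf ji.
by rewrite ffunE ji.
Qed.

Lemma weight_edge x y : hypercube_edge x y -> weight y = (weight x).+1.
Proof.
move=> /hypercube_edgeP[i xi ->].
rewrite /weight (cardsD1 i) inE ffunE eqxx (negPf xi) add1n; congr _.+1.
apply: eq_card => j; rewrite !inE ffunE.
by case: eqVneq => // ->; rewrite (negPf xi).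
Qed.

Lemma hypercube_indegree v : #|[set x | hypercube_edge x v]| = weight v.
Proof.
rewrite /weight -(card_imset _ (@flip_inj v)); apply: eq_card => x; rewrite inE.
have flipK (z : hypercube_vertex d) i : flip (flip z i) i = z.
  by apply/ffunP => j; rewrite !ffunE addKb.
apply/hypercube_edgeP/imsetP => -[i]; rewrite ?inE => vi E; exists i.
- by rewrite inE E ffunE eqxx.
- by rewrite E flipK.
- by rewrite E ffunE eqxx vi.
- by rewrite E flipK.
Qed.

Lemma hypercube_outdegree x : #|[set y | hypercube_edge x y]| <= d.
Proof.
rewrite -[leqRHS]card_ord -cardsT (leq_trans _ (leq_imset_card (flip x) _)) //.
apply/subset_leq_card/subsetP => y; rewrite inE => /hypercube_edgeP[i _ ->].
by rewrite imset_f.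
Qed.

Lemma card_weight k : #|[set x | weight x == k]| <= 'C(d, k).
Proof.
rewrite -[d in leqRHS]card_ord -card_draws.
rewrite -(@card_imset _ _ (fun x => [set i | x i])) => [|x y /setP xy].
  apply/subset_leq_card/subsetP => A /imsetP[x].
  by rewrite !inE => xk ->.
by apply/ffunP => i; have := xy i; rewrite !inE.
Qed.

Lemma weight_le x : weight x <= d.
Proof. by rewrite -[leqRHS]card_ord max_card. Qed.

End Hypercube.

(** * Numerical estimates *)

Lemma bernoulli_pow m n : n <= m.+1 ->
  m.+1 ^ n * (m.+1 - n) <= m ^ n * m.+1.
Proof.
elim: n => [|n IHn] ltn; first by rewrite !expn0 subn0.
have := IHn (ltnW ltn); rewrite !expnS; set a := m.+1 ^ n; set b := m ^ n.
have -> : m.+1 - n = (m.+1 - n.+1).+1 by lia.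
set c := m.+1 - n.+1 => IH.
have : m.+1 * c <= m * c.+1 by rewrite /c; lia.
by move: IH; nia.
Qed.

(* That is, [(1 - 1 / 4d) ^ 2h >= 1 / 2]. *)
Lemma density_pow d h : h <= d -> 0 < d ->
  (2 * (4 * d)) ^ (2 * h) <= 2 * 4 ^ h * (4 * d).-1 ^ (2 * h).
Proof.
move=> lehd d0; rewrite expnMn expnM -(mulnA 2) mulnCA leq_mul //.
have := @bernoulli_pow (4 * d).-1 (2 * h); rewrite prednK; last by lia.
have le2 : 2 * h <= 4 * d by lia.
move=> /(_ le2); set a := (_ * _) ^ _; set b := _ ^ _ => leab.
(* Bernoulli leaves the factor [(4d - 2h) / 4d], at least [1 / 2] because [h <= d]. *)
rewrite -(@leq_pmul2r (2 * d)); last by lia.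
apply: leq_trans (_ : a * (4 * d - 2 * h) <= _); first by rewrite leq_mul; lia.
by move: leab; lia.
Qed.

Lemma binomial_term_le a b n k :
  'C(n, k) * (a ^ (n - k) * b ^ k) <= (a + b) ^ n.
Proof.
have [lekn|ltnk] := leqP k n; last by rewrite bin_small.
have ltk : k < n.+1 by [].
by rewrite expnDn (bigD1 (Ordinal ltk)) //= leq_addr.
Qed.

(** * Choice of the levels and embedding of the cube *)

Section Embedding.
Variables (d : nat) (T : finType) (e : rel T).
Hypothesis d_gt0 : 0 < d.

(* Good sets of [i+1] vertices in level [i] have a fraction [1 / G (i+1)] of
   level [i+1] as common out-neighbours; level [i] has at least [k i] vertices,
   and [l] is the length of the blocks. *)
Let G i := 2 * d * 4 ^ i.
Let k i := 2 * 'C(d, i) * G i.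
Let l := 64 * d * 17 ^ d.

Hypothesis cardT : #|T| = 5 * d ^ 2 * l.

Variable pos : T -> nat.
Hypotheses (pos_inj : injective pos) (pos_lt : forall x, pos x < #|T|)
  (pos_med : forall i x, i <= pos x ->
     pos x - i <= 2 * #|[set y | i <= pos y < pos x & e y x]|).

(** Dependent random choice with [h = i + 1], [t = 2h] and density [(4d - 1) / 8d]. As [t = 2h],
    both numerical conditions reduce to comparisons of [h]-th powers, settled by [density_pow]
    together with [4 * 4^(i+1) * k i <= l] and [G (i+1)^2 = 4 * 4^(i+1) * (2d * G i)]. *)
Lemma level_below i b (U : {set T}) : i < d -> 0 < #|U| ->
  U \subset block pos l b -> 4 * d <= b <= 4 * d * d ->
  exists c (W : {set T}), [/\ c < b, b <= c + 4 * d, W \subset block pos l c,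
    k i <= #|W| & ~~ dangerous W (2 * d * G i) (scarce e U (G i.+1)) i.+1 set0].
Proof.
move=> ltid U0 sUb /andP[lb ub].
have bT n : n <= 4 * d * d -> n.+1 * l <= #|T|.
  by move=> len; rewrite cardT leq_mul // -mulnn; nia.
have [|c [ltcb lebc dense]] :=
    dense_earlier_block pos_inj pos_lt pos_med _ lb (bT _ ub) sUb; first by lia.
have cA : #|block pos l c| = l by rewrite card_block // bT //; lia.
have l0 : 0 < l by rewrite /l !muln_gt0 d_gt0 expn_gt0.
have k0 : 0 < k i by rewrite /k /G !muln_gt0 bin_gt0 d_gt0 expn_gt0 (ltnW ltid).
set p := (4 * d).-1 in dense; set q := 2 * (4 * d) in dense.
have dpow : q ^ (2 * i.+1) <= 2 * 4 ^ i.+1 * p ^ (2 * i.+1).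
  exact: density_pow.
have [||||||W sW [leW safeW]] := @dependent_random_choice _ e (block pos l c) U
    i.+1 (2 * i.+1) p q (2 * d * G i) (G i.+1) (k i) _ k0 _ _ U0 _ _ _.
- by [].
- by rewrite /q; lia.
- by rewrite cA.
- by rewrite cA.
(* Enlarging the factor [2] to [2 ^ i.+1] puts everything under one exponent, which can then be
   dropped. *)
- rewrite cA; apply: leq_trans (_ : (2 * (q ^ (2 * i.+1) * k i)) ^ i.+1 <= _).
    by rewrite [leqRHS]expnMn leq_mul // -{1}(expn1 2) leq_pexp2l.
  rewrite leq_exp2r //.
  apply: leq_trans (_ : 2 * (2 * 4 ^ i.+1 * p ^ (2 * i.+1) * k i) <= _).
    by rewrite !leq_mul.
  (* The left side is [64 d C(d,i) 16^i], one term of [64 d (1 + 16)^d]; this fixes the constants in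
     [l]. *)
  have kl : 4 * 4 ^ i.+1 * k i <= l.
    have := binomial_term_le 1 16 d i; rewrite exp1n mul1n => leC.
    apply: leq_trans (_ : 64 * d * ('C(d, i) * 16 ^ i) <= _);
      last by rewrite leq_mul.
    by rewrite /k /G expnS -[16]/(4 * 4) expnMn; lia.
  by rewrite mulnC; move: kl; set P := p ^ _; nia.
- have GE : G i.+1 ^ 2 = 4 * 4 ^ i.+1 * (2 * d * G i).
    by rewrite -mulnn /G expnS; set x := 4 ^ i; lia.
  rewrite (expnM (G _)) GE (mulnC i.+1) !(expnM _ (2 * i.+1)) -!expnMn.
  apply: leq_trans (_ : (2 * (q ^ (2 * i.+1) * (2 * d * G i))) ^ i.+1 <= _).
    by rewrite [leqRHS]expnMn leq_mul // -{1}(expn1 2) leq_pexp2l.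
  rewrite leq_exp2r //.
  apply: leq_trans
    (_ : 2 * (2 * 4 ^ i.+1 * p ^ (2 * i.+1) * (2 * d * G i)) <= _).
    by rewrite !leq_mul.
  by set P := p ^ _; set Q := 4 ^ _; set B := 2 * d * _; lia.
by exists c, W; split.
Qed.

(** After [n] descents from the top the block index is still at least [4d(d - n)], which leaves [4d]
    blocks for each level to come. *)
Lemma level_chain : exists (b : nat -> nat) (U : nat -> {set T}),
  [/\ forall i, i < d -> b i < b i.+1,
    forall i, i <= d -> U i \subset block pos l (b i) /\ k i <= #|U i| &
    forall i, i < d ->
      ~~ dangerous (U i) (2 * d * G i) (scarce e (U i.+1) (G i.+1)) i.+1 set0].
Proof.
have chain n : n <= d -> exists (b : nat -> nat) (U : nat -> {set T}),
  [/\ 4 * d * (d - n) <= b (d - n) <= 4 * d * d,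
    forall i, d - n <= i < d -> b i < b i.+1,
    forall i, d - n <= i <= d ->
      U i \subset block pos l (b i) /\ k i <= #|U i| &
    forall i, d - n <= i < d ->
      ~~ dangerous (U i) (2 * d * G i) (scarce e (U i.+1) (G i.+1)) i.+1 set0].
  elim: n => [_|n IHn ltn].
    (* The top level is the whole block [4d^2]; this block exists because [4d^2 + 1 <= 5d^2]. *)
    exists (fun=> 4 * d * d), (fun=> block pos l (4 * d * d)).
    rewrite subn0 leqnn; split=> // i id; try lia.
    have -> : i = d by lia.
    split=> //; rewrite card_block //; last first.
      by rewrite cardT leq_mul // -mulnn; nia.
    rewrite /k /G /l binn muln1.
    apply: leq_trans (_ : 4 * d * 4 ^ d <= _); first by lia.
    by rewrite leq_mul ?leq_exp2r //; lia.
  have [b [U [bn bS Ub safeU]]] := IHn (ltnW ltn).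
  pose i := d - n.+1; have iS : d - n = i.+1 by rewrite /i; lia.
  rewrite iS in bn bS Ub safeU; rewrite -/i.
  have ltid : i < d by lia.
  have [|sU leU] := Ub i.+1; first by lia.
  have U0 : 0 < #|U i.+1|.
    by rewrite (leq_trans _ leU) // /k /G !muln_gt0 bin_gt0 d_gt0 expn_gt0 ltid.
  have [|c [W [ltc lec sW leW safeW]]] := level_below ltid U0 sU; first by nia.
  exists (fun j => if j == i then c else b j).
  exists (fun j => if j == i then W else U j).
  rewrite eqxx; split=> [|j ij|j ij|j ij].
  - by nia.
  - rewrite (_ : (j.+1 == i) = false); last by lia.
    by case: eqVneq => [->//|ji]; apply: bS; lia.
  - by case: eqVneq => [->//|ji]; apply: Ub; lia.
  - rewrite (_ : (j.+1 == i) = false); last by lia.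
    by case: eqVneq => [->//|ji]; apply: safeU; lia.
have [b [U [_ bS Ub safeU]]] := chain d (leqnn d).
rewrite subnn in bS Ub safeU.
by exists b, U; split=> i id; [apply: bS|apply: Ub|apply: safeU].
Qed.

Lemma hypercube_copy : contains_copy (@hypercube_edge d) e.
Proof.
have [b [U [bS Ub safeU]]] := level_chain.
have b_lt i j : i < j -> j <= d -> b i < b j.
  elim: j => // j IHj; rewrite ltnS leq_eqVlt => /predU1P[->|ltij] ltj.
    exact: bS.
  exact: ltn_trans (IHj ltij (ltnW ltj)) (bS _ ltj).
apply: (@greedy_embedding _ _ _ e (@weight d) U G d) => //.
- exact: weight_edge.
- exact: hypercube_outdegree.
- by move=> i; rewrite /G !muln_gt0 d_gt0 expn_gt0.
- move=> x y t.
  (* Distinct levels lie in distinct blocks, hence are disjoint. *)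
  have disj i j : i < j -> j <= d -> t \in U i -> t \in U j -> False.
    move=> ij jd /(subsetP (Ub _ (leq_trans (ltnW ij) jd)).1) ti.
    move=> /(subsetP (Ub _ jd).1); move: ti; rewrite !inE => ti tj.
    have : (b i).+1 * l <= b j * l by rewrite leq_mul // b_lt.
    by lia.
  case: (ltngtP (weight x) (weight y)) => // xy tx ty.
    by case: (disj _ _ xy (weight_le y) tx ty).
  by case: (disj _ _ xy (weight_le x) ty tx).
- move=> v; apply: leq_trans (Ub _ (weight_le v)).2.
  by rewrite /k !leq_mul // card_weight.
(* A vertex of weight [i + 1] has in-degree [i + 1], the tuple length for which level [i] was made
   safe. *)
- move=> v i vi; rewrite hypercube_indegree vi; apply: safeU.
  by rewrite -vi weight_le.
Qed.

End Embedding.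

Lemma hypercube_unavoidable d : 0 < d ->
  unavoidable (@hypercube_edge d) (5 * d ^ 2 * (64 * d * 17 ^ d)).
Proof.
move=> d0 T e cT te; have [pos [pos_inj pos_lt pos_med]] := median_ranking te.
exact: (hypercube_copy d0 cT pos_inj pos_lt pos_med).
Qed.

Import GRing.Theory Num.Theory.

Local Open Scope ring_scope.

Theorem theorem1p4 (R : realType) :
  exists C : R, 0 < C /\
    forall d : nat, (1 <= d)%N ->
      (oriented_ramsey (@hypercube_acyclic d))%:R
        <= C * d%:R ^+ 3 * 17%:R ^+ d.
Proof.
(* [320 = 5 * 64]: the constant in the number of blocks times that in their length. *)
exists 320%:R; split=> [|d d1]; first by rewrite ltr0n.
rewrite -!natrX -!natrM ler_nat.
apply: leq_trans ((oriented_ramseyP _).2 _ (hypercube_unavoidable d1)) _.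
suff -> : (5 * d ^ 2 * (64 * d * 17 ^ d) = 320 * d ^ 3 * 17 ^ d)%N by [].
by lia.
Qed.
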